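(* Consider the finite-horizon MDP, the augmented MDP, the functions $f_\theta$ and the empirical risk $\hat{\mathcal R}^\pi_n$ described in the context. There is a universal constant $C>0$ such that the following holds. Let $\pi$ be a randomized Markovian policy of the augmented MDP such that, for some $L_\pi>0$, $$\|\pi_t(\cdot|s,x)-\pi_t(\cdot|s,x')\|_1\le L_\pi|x-x'|\qquad\text{for all }0\le t\le T,\ s\in\mathcal S_t,\ x,x'\in\mathcal X_t.$$ For any $\epsilon>0$ and $\delta\in(0,1)$, take $$n=\left\lceil C\,\frac{T^2L_C^2}{\epsilon^2}\log\left(\frac{T^4|\mathcal S|\,L_C\,L_\pi\,(L_\Theta R_\Theta/\epsilon)^{d_\Theta}}{\delta\,\epsilon}\right)\right\rceil,$$ where inside the logarithm each of the quantities $L_C$, $L_\pi$, $L_\Theta R_\Theta/\epsilon$, $1/\epsilon$ is read as the maximum of itself and $2$. Then with probability at least $1-\delta$, $$|\hat{\mathcal R}^\pi_n(s)-\mathcal R^\pi(s)|\le\epsilon\qquad\text{for all }s\in\mathcal S_0.$$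
   Context: MDP: $T$ is a positive integer; for $0\le t\le T$, $\mathcal S_t$ is a finite state space, $\mathcal A_t$ a finite action space, and $c_t:\mathcal S_t\times\mathcal A_t\to[0,1]$ a cost function; for $0\le t\le T-1$, $\mathbb P_t(\cdot|s,a)$ is a probability distribution on $\mathcal S_{t+1}$ for each $(s,a)$. $|\mathcal S|=\max_t|\mathcal S_t|$. Augmented state: $\mathcal X_t=[0,t]$, $X_0=0$, $X_{t+1}=X_t+c_t(S_t,A_t)$. A randomized Markovian policy $\pi$ of the augmented MDP assigns to each stage $t$ and $(s,x)\in\mathcal S_t\times\mathcal X_t$ a probability distribution $\pi_t(\cdot|s,x)$ on $\mathcal A_t$; $A_t\sim\pi_t(\cdot|S_t,X_t)$, $S_{t+1}\sim\mathbb P_t(\cdot|S_t,A_t)$. Risk: $\mathcal R^\pi(s)=\min_{\theta\in\Theta}\mathbb E^\pi_{\mathbb P}[f_\theta(\sum_{t=0}^Tc_t(S_t,A_t))\mid S_0=s]$, with $\Theta\subseteq\mathbb R^{d_\Theta}$ and $f_\theta:\mathbb R\to\mathbb R$. Standing assumption: $|f_\theta(z)-f_\theta(z')|\le L_C|z-z'|$ and $|f_\theta(z)-f_{\theta'}(z)|\le L_\Theta\|\theta-\theta'\|$ for all $z,z'\in[0,T+1]$, $\theta,\theta'\in\Theta$; $\Theta$ is bounded with radius $R_\Theta$ in the Euclidean norm. Sampling: for every $t$ and $(s,a)\in\mathcal S_t\times\mathcal A_t$ one draws $n$ i.i.d. samples from $\mathbb P_t(\cdot|s,a)$ (independently over $(t,s,a)$);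 $\hat{\mathbb P}_{t,n}(\cdot|s,a)$ is the resulting empirical distribution. $\hat{\mathcal R}^\pi_n(s)$ is the risk $\mathcal R^\pi(s)$ with $\{\mathbb P_t\}$ replaced by $\{\hat{\mathbb P}_{t,n}\}$. The policy $\pi$ is fixed (does not depend on the samples). *)

(* Defs.v *)
From HB Require Import structures.
From mathcomp Require Import all_boot all_order all_algebra.
From mathcomp Require Import all_classical all_reals all_analysis.
Set Implicit Arguments.
Unset Strict Implicit.
Unset Printing Implicit Defensive.
Import Order.TTheory GRing.Theory Num.Theory.
Import numFieldNormedType.Exports.
Local Open Scope classical_set_scope.
Local Open Scope ring_scope.

(* The norm `|v| that the library puts on row vectors is the sup norm. *)
Definition norm2 (R : realType) (k : nat) (v : 'rV[R]_k) : R :=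
  Num.sqrt (\sum_(i < k) v ord0 i ^+ 2).

Definition is_pmf (R : realType) (Y : finType) (p : Y -> R) : Prop :=
  (forall y, 0 <= p y) /\ \sum_(y : Y) p y = 1.

(* State and action spaces are families over nat, so that S t.+1 makes sense;
   only the stages t <= T are ever used.  Costs and policies are indexed by
   the stages 0..T, i.e. 'I_T.+1, and transition kernels by 0..T-1, i.e. 'I_T.
   For t : 'I_T, the stages t and t+1 are obtained in 'I_T.+1 as stage_of t and
   next_stage t; their values are convertible to t and t.+1. *)

Definition stage_of (T : nat) (t : 'I_T) : 'I_T.+1 := widen_ord (leqnSn T) t.
Definition next_stage (T : nat) (t : 'I_T) : 'I_T.+1 := lift ord0 t.

Definition costs (R : realType) (T : nat) (S A : nat -> finType) : Type :=
  forall t : 'I_T.+1, S t -> A t -> R.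

Definition trans_kernel (R : realType) (T : nat) (S A : nat -> finType) : Type :=
  forall t : 'I_T, S t -> A t -> S t.+1 -> R.

Definition policy (R : realType) (T : nat) (S A : nat -> finType) : Type :=
  forall t : 'I_T.+1, S t -> R -> A t -> R.

Definition is_cost (R : realType) (T : nat) (S A : nat -> finType)
    (c : costs R T S A) : Prop :=
  forall (t : 'I_T.+1) (s : S t) (a : A t), 0 <= c t s a <= 1.

Definition is_trans_kernel (R : realType) (T : nat) (S A : nat -> finType)
    (K : trans_kernel R T S A) : Prop :=
  forall (t : 'I_T) (s : S t) (a : A t), is_pmf (K t s a).

Definition is_policy (R : realType) (T : nat) (S A : nat -> finType)
    (pol : policy R T S A) : Prop :=
  forall (t : 'I_T.+1) (s : S t) (x : R), 0 <= x <= t%:R -> is_pmf (pol t s x).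

Definition lipschitz_policy (R : realType) (T : nat) (S A : nat -> finType)
    (pol : policy R T S A) (L : R) : Prop :=
  forall (t : 'I_T.+1) (s : S t) (x x' : R),
    0 <= x <= t%:R -> 0 <= x' <= t%:R ->
    \sum_(a : A t) `|pol t s x a - pol t s x' a| <= L * `|x - x'|.

Definition max_state_card (T : nat) (S : nat -> finType) : nat :=
  \max_(t < T.+1) #|{: S t}|.

Definition trajectory (T : nat) (S A : nat -> finType) : finType :=
  {dffun forall t : 'I_T.+1, (S t * A t)%type}.

(* The value of the augmented coordinate X_t, for X_0 = 0 and
   X_{t+1} = X_t + c_t(S_t, A_t). *)
Definition past_cost (R : realType) (T : nat) (S A : nat -> finType)
    (c : costs R T S A) (w : trajectory T S A) (t : 'I_T.+1) : R :=
  \sum_(u < T.+1 | (u < t)%N) c u (w u).1 (w u).2.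

Definition total_cost (R : realType) (T : nat) (S A : nat -> finType)
    (c : costs R T S A) (w : trajectory T S A) : R :=
  \sum_(t < T.+1) c t (w t).1 (w t).2.

(* Conditional probability of the trajectory w given that S_0 is its
   initial state. *)
Definition traj_prob (R : realType) (T : nat) (S A : nat -> finType)
    (c : costs R T S A) (K : trans_kernel R T S A) (pol : policy R T S A)
    (w : trajectory T S A) : R :=
  (\prod_(t < T.+1) pol t (w t).1 (past_cost c w t) (w t).2) *
  (\prod_(t < T) K t (w (stage_of t)).1 (w (stage_of t)).2
                     (w (next_stage t)).1).

(* E^pi_K [ g (sum_t c_t(S_t, A_t)) | S_0 = s ] *)
Definition expected (R : realType) (T : nat) (S A : nat -> finType)
    (c : costs R T S A) (K : trans_kernel R T S A) (pol : policy R T S A)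
    (g : R -> R) (s : S 0%N) : R :=
  \sum_(w : trajectory T S A | (w ord0).1 == s)
    traj_prob c K pol w * g (total_cost c w).

(* The infimum is the minimum whenever the latter is attained. *)
Definition risk (R : realType) (T : nat) (S A : nat -> finType)
    (c : costs R T S A) (k : nat) (Theta : set 'rV[R]_k)
    (f : 'rV[R]_k -> R -> R) (K : trans_kernel R T S A) (pol : policy R T S A)
    (s : S 0%N) : R :=
  inf [set expected c K pol (f theta) s | theta in Theta].

Definition mutually_independent (R : realType) (d : measure_display)
    (Omega : measurableType d) (P : probability Omega R) (I : finType)
    (Y : I -> finType) (X : forall i : I, Omega -> Y i) : Prop :=
  forall (J : {set I}) (B : forall i : I, set (Y i)),
    P (\bigcap_(i in [set` J]) (X i @^-1` B i)) =
    (\prod_(i in J) P (X i @^-1` B i))%E.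

(* The index (t; (s, a, i)) stands for the i-th sample drawn from
   P_t(. | s, a). *)
Definition sample_index (T : nat) (S A : nat -> finType) (n : nat) : finType :=
  {t : 'I_T & (S t * A t * 'I_n)%type}.

Definition sample_idx (T : nat) (S A : nat -> finType) (n : nat)
    (t : 'I_T) (s : S t) (a : A t) (i : 'I_n) : sample_index T S A n :=
  Tagged (fun t : 'I_T => (S t * A t * 'I_n)%type) (s, a, i).

Definition sample_family (T : nat) (S A : nat -> finType) (n : nat)
    (Omega : Type) : Type :=
  forall j : sample_index T S A n, Omega -> S (tag j).+1.

(* The state spaces carry the discrete sigma-algebra. *)
Definition is_sampling (R : realType) (T : nat) (S A : nat -> finType)
    (K : trans_kernel R T S A) (n : nat) (d : measure_display)
    (Omega : measurableType d) (P : probability Omega R)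
    (X : sample_family T S A n Omega) : Prop :=
  [/\ forall j B, measurable (X j @^-1` B),
      forall (t : 'I_T) (s : S t) (a : A t) (i : 'I_n) (s' : S t.+1),
        P (X (sample_idx s a i) @^-1` [set s']) = (K t s a s')%:E
    & mutually_independent P X].

Definition empirical (R : realType) (T : nat) (S A : nat -> finType) (n : nat)
    (Omega : Type) (X : sample_family T S A n Omega) (w : Omega) :
    trans_kernel R T S A :=
  fun t s a s' => #|[set i : 'I_n | X (sample_idx s a i) w == s']%SET|%:R / n%:R.
Arguments empirical R {T S A n Omega} X w.

Definition log_argument (R : realType) (T cardS k : nat)
    (LC Lpi LTheta RTheta eps delta : R) : R :=
  T%:R ^+ 4 * cardS%:R * Num.max LC 2 * Num.max Lpi 2 *
  Num.max (LTheta * RTheta / eps) 2 ^+ k * Num.max eps^-1 2 / delta.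

(* Main.v *)
Require Import Defs.
From HB Require Import structures.
From mathcomp Require Import all_boot all_order all_algebra.
From mathcomp Require Import all_classical all_reals all_analysis.
From mathcomp Require Import ring lra.
Set Implicit Arguments.
Unset Strict Implicit.
Unset Printing Implicit Defensive.
Import Order.TTheory GRing.Theory Num.Theory.
Import numFieldNormedType.Exports.
Local Open Scope classical_set_scope.
Local Open Scope ring_scope.

(* The empirical kernel is the average of n i.i.d. deterministic dynamics, the
   i-th one using the i-th sample of every (t, s, a).  The expected cost is
   multilinear in the stage kernels, so its empirical version is the average,
   over all ways of choosing one of the n dynamics at each stage, of the cost
   under the spliced dynamics.  As in Hoeffding's treatment of U-statistics,
   cyclic shifts turn this into an average of means of n i.i.d. bounded
   unbiased variables; convexity of exp then gives the sub-Gaussian tail of a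
   single mean, with range L_C (T + 1) and no dependence on the actions or on
   the regularity of the policy.  A union bound over S_0 and over a net of
   Theta concludes. *)

(** * Finite product sums *)

(** Distributivity for coordinates of varying type: in the [fprod] encoding they become tagged
    values of one common type, where [bigA_distr_big_dep] applies. *)
Lemma sum_dffun_prod (R : comNzRingType) (I : finType) (Y : I -> finType)
    (F : forall i, Y i -> R) :
  \sum_(w : {dffun forall i, Y i}) \prod_i F i (w i) =
  \prod_i \sum_(y : Y i) F i y.
Proof.
rewrite (reindex (@dffun_of_fprod I Y)); last first.
  exact/onW_bij/dffun_of_fprod_bij.
under eq_bigr => t _ do
  under eq_bigr => i _ do rewrite /dffun_of_fprod ffunE -[F i _]ffunE.
rewrite (big_fprod 1 +%R (fun i => [ffun y => F i y])).
under [in RHS]eq_bigr => i _ do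
  [under eq_bigr => y _ do rewrite -[F i y]ffunE].
under [in RHS]eq_bigr => i _ do rewrite (big_tag (fun i y => [ffun y => F i y] y)).
by rewrite bigA_distr_big_dep.
Qed.

Definition update (I : finType) (Y : I -> finType)
    (w : {dffun forall i, Y i}) (i : I) (y : Y i) : {dffun forall i, Y i} :=
  [ffun j => dfwith w i y j].
Arguments update {I Y} w {i} y.

Lemma update_same (I : finType) (Y : I -> finType)
    (w : {dffun forall i, Y i}) (i : I) (y : Y i) : update w y i = y.
Proof. by rewrite ffunE dfwithin. Qed.

Lemma update_other (I : finType) (Y : I -> finType)
    (w : {dffun forall i, Y i}) (i j : I) (y : Y i) :
  i != j -> update w y j = w j.
Proof. by move=> ij; rewrite ffunE dfwithout. Qed.

Lemma update_update (I : finType) (Y : I -> finType)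
    (w : {dffun forall i, Y i}) (i : I) (y z : Y i) :
  update (update w y) z = update w z.
Proof.
apply/ffunP => j; have [<-|ij] := eqVneq i j; first by rewrite !update_same.
by rewrite !update_other.
Qed.

Lemma update_id (I : finType) (Y : I -> finType)
    (w : {dffun forall i, Y i}) (i : I) : update w (w i) = w.
Proof.
apply/ffunP => j; have [<-|ij] := eqVneq i j; first by rewrite update_same.
by rewrite update_other.
Qed.

(** Total mass of a sequential law. Among the factors of index at most m only factor m sees
    coordinate m, so summing out that coordinate removes the factor, and induction does the rest. *)
Lemma sum_causal_prod (R : comNzRingType) (N : nat) (Y : 'I_N -> finType)
    (F : 'I_N -> {dffun forall t, Y t} -> R) (w0 : {dffun forall t, Y t}) :
  (forall (t : 'I_N) (w w' : {dffun forall t, Y t}),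
     (forall u : 'I_N, (u <= t)%N -> w u = w' u) ->
     F t w = F t w') ->
  (forall (t : 'I_N) (w : {dffun forall t, Y t}),
     \sum_(y : Y t) F t (update w y) = 1) ->
  \sum_w \prod_t F t w = 1.
Proof.
move=> causal norm.
(* Sum out the coordinates one at a time, the coordinates >= m being frozen
   at those of w0. *)
pose W (m : nat) : pred {dffun forall t, Y t} :=
  fun w => [forall t : 'I_N, (m <= t)%N ==> (w t == w0 t)].
have frozen m : (m <= N)%N -> \sum_(w | W m w) \prod_(t : 'I_N | (t < m)%N) F t w = 1.
  elim: m => [_|m IHm ltmN].
    rewrite (big_pred1 w0) ?big_pred0// => w; apply/forallP/eqP => [ww0|-> t].
      by apply/ffunP => t; apply/eqP; have := ww0 t.
    by rewrite eqxx implybT.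
  pose t0 := Ordinal ltmN.
  rewrite -[RHS](IHm (ltnW ltmN)).
  (* A function free below [m.+1] splits into one free below [m] and its value at coordinate [m];
     the inverse map resets that value to [w0 t0]. *)
  rewrite (reindex_onto (fun q : {dffun forall t, Y t} * Y t0 => update q.1 q.2)
    (fun w => (update w (w0 t0), w t0))) /=; last first.
    by move=> w _; rewrite update_update update_id.
  transitivity (\sum_(w | W m w) \sum_(y : Y t0)
      \prod_(t : 'I_N | (t < m.+1)%N) F t (update w y)).
    rewrite pair_big; apply: eq_bigl => -[w y] /=; rewrite andbT.
    rewrite update_update update_same xpair_eqE eqxx andbT.
    apply/andP/forallP => [[/forallP ww0 /eqP ew] t|ww0].
      apply/implyP => lemt; rewrite -ew; have [e|ne] := eqVneq t0 t.
        by rewrite -e update_same.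
      rewrite update_other//; have /implyP := ww0 t.
      rewrite update_other//; apply; rewrite ltn_neqAle lemt andbT.
      by apply: contra ne => /eqP e; apply/eqP/val_inj.
    split; last first.
      by have := ww0 t0; rewrite leqnn => /eqP <-; rewrite update_id.
    apply/forallP => t; apply/implyP => ltmt; rewrite update_other; last first.
      by apply/eqP => e; move: ltmt; rewrite -e ltnn.
    by have /implyP := ww0 t; apply; exact: ltnW.
  apply: eq_bigr => w _.
  rewrite -[RHS]mulr1 -(norm t0 w) mulr_sumr; apply: eq_bigr => y _.
  rewrite (bigD1 t0)/= ?ltnSn// mulrC; congr (_ * _).
  apply: eq_big => [t|t /andP[]].
    rewrite ltnS leq_eqVlt -(inj_eq val_inj) /=.
    by case: (ltngtP t m).
  rewrite ltnS => letm net; apply: causal => u leut.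
  rewrite update_other//; apply: contra net => /eqP e; rewrite -e in leut.
  by apply/eqP/val_inj/eqP; rewrite eqn_leq letm.
have := frozen N (leqnn N).
rewrite (eq_bigl xpredT) => [|w]; last first.
  by apply/forallP => t; rewrite leqNgt ltn_ord.
by move=> frozenN; rewrite -[RHS]frozenN; apply: eq_bigr => w _;
  apply: eq_bigl => t; rewrite ltn_ord.
Qed.

(** * Trajectories *)

Lemma pmf_inhabited (R : realType) (Y : finType) (p : Y -> R) :
  is_pmf p -> inhabited Y.
Proof.
move=> [_ p1]; case: (pickP [pred y : Y | true]) => [y _|Y0]; first by exists.
by move: p1; rewrite big_pred0// => /eqP; rewrite eq_sym oner_eq0.
Qed.

Section Trajectories.
Variables (R : realType) (T : nat) (S A : nat -> finType).
Variables (c : costs R T S A) (pol : policy R T S A).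
Hypotheses (cost_c : is_cost c) (policy_pol : is_policy pol).
Arguments c : clear implicits.
Arguments pol : clear implicits.
Arguments cost_c : clear implicits.
Arguments policy_pol : clear implicits.
Implicit Types (K : trans_kernel R T S A) (w : trajectory T S A).
Implicit Types (g h : R -> R) (s : S 0%N).

(** [is_policy] only concerns augmented values in [0, t]; this bound is what makes the policy a
    distribution along every trajectory. *)
Lemma past_cost_itv w (t : 'I_T.+1) : 0 <= past_cost c w t <= t%:R.
Proof.
apply/andP; split.
  by apply: sumr_ge0 => u _; case/andP: (cost_c u (w u).1 (w u).2).
apply: (@le_trans _ _ (\sum_(u < T.+1 | (u < t)%N) 1)).
  by apply: ler_sum => u _; case/andP: (cost_c u (w u).1 (w u).2).
by rewrite (big_ord_narrow (ltnW (ltn_ord t))) /= sumr_const card_ord.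
Qed.

Lemma total_cost_itv w : 0 <= total_cost c w <= T.+1%:R.
Proof.
apply/andP; split.
  by apply: sumr_ge0 => u _; case/andP: (cost_c u (w u).1 (w u).2).
apply: (@le_trans _ _ (\sum_(u < T.+1) 1)).
  by apply: ler_sum => u _; case/andP: (cost_c u (w u).1 (w u).2).
by rewrite sumr_const card_ord.
Qed.

Lemma traj_prob_ge0 K w : is_trans_kernel K -> 0 <= traj_prob c K pol w.
Proof.
move=> kernelK; apply: mulr_ge0; apply: prodr_ge0 => t _.
  by case: (policy_pol t (w t).1 _ (past_cost_itv w t)).
by case: (kernelK t (w (stage_of t)).1 (w (stage_of t)).2).
Qed.

(** Supplies the base point of [sum_causal_prod]. Nonemptiness propagates from [s]: a distribution
    has a nonempty carrier, so the policy yields an action and the kernel then yields a next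
    state. *)
Lemma trajectory_inhabited K s :
  is_trans_kernel K -> inhabited (trajectory T S A).
Proof.
move=> kernelK.
have actions (t : 'I_T.+1) : S t -> inhabited (A t).
  move=> st; apply: (@pmf_inhabited R _ (pol t st 0)).
  by apply: policy_pol; rewrite lexx ler0n.
have states (t : nat) : (t < T.+1)%N -> inhabited (S t).
  elim: t => [//|t IHt] ltT; have [st] := IHt (ltnW ltT).
  have [a] := actions (Ordinal (ltnW ltT)) st.
  exact: (pmf_inhabited (kernelK (Ordinal (ltT : (t < T)%N)) st a)).
have pairs (t : 'I_T.+1) : exists y : (S t * A t)%type, true.
  have [st] := states t (ltn_ord t); have [a] := actions t st.
  by exists (st, a).
exists; exact: [ffun t => sval (cid (pairs t))].
Qed.

Lemma sum_traj_prob K s : is_trans_kernel K ->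
  \sum_(w : trajectory T S A | (w ord0).1 == s) traj_prob c K pol w = 1.
Proof.
move=> kernelK; have [w0] := trajectory_inhabited s kernelK.
(* The factor for entering stage t: a transition probability, or the indicator of [s] at stage 0.
   The constraint on the initial state thus becomes one more causal factor. *)
pose enter (t : 'I_T.+1) (w : trajectory T S A) : R :=
  if unlift ord0 t is Some t' then
    K t' (w (stage_of t')).1 (w (stage_of t')).2 (w (next_stage t')).1
  else ((w ord0).1 == s)%:R.
pose F (t : 'I_T.+1) (w : trajectory T S A) : R :=
  enter t w * pol t (w t).1 (past_cost c w t) (w t).2.
rewrite big_mkcond /= -(@sum_causal_prod R _ _ F w0).
- apply: eq_bigr => w _; rewrite /F big_split /= big_ord_recl.
  rewrite [enter ord0 w]/enter unlift_none.
  rewrite [X in _ * X * _](eq_bigr (fun t => K t (w (stage_of t)).1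
    (w (stage_of t)).2 (w (next_stage t)).1)) => [|t _].
    case: eqP => _; rewrite ?(mul1r, mul0r)//; exact: mulrC.
  by rewrite /enter liftK.
- move=> t w w' ww'; rewrite /F /past_cost ww'//.
  rewrite [X in enter t w * pol _ _ X _](_ : _ = past_cost c w' t); last first.
    by apply: eq_bigr => u ltut; rewrite ww'// ltnW.
  congr (_ * _); rewrite /enter; case: unliftP => [t' e|e].
    by subst t; rewrite (ww' (stage_of t')) ?(ww' (next_stage t'))//; exact: leqnSn.
  by rewrite ww'.
- move=> t w.
  have past (y : (S t * A t)%type) : past_cost c (update w y) t = past_cost c w t.
    apply: eq_bigr => u ltut; rewrite update_other//.
    by apply: contraTneq ltut => ->; rewrite ltnn.
  transitivity (\sum_(s' : S t) \sum_(a : A t)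
      enter t (update w (s', a)) * pol t s' (past_cost c w t) a).
    rewrite pair_bigA; apply: eq_bigr => -[s' a] _.
    by rewrite /F past update_same.
  have pol1 (s' : S t) : \sum_(a : A t) pol t s' (past_cost c w t) a = 1.
    by case: (policy_pol t s' _ (past_cost_itv w t)).
  rewrite /enter; case: unliftP => [t' e|e].
    subst t; transitivity (\sum_(s' : S t'.+1)
        K t' (w (stage_of t')).1 (w (stage_of t')).2 s').
      apply: eq_bigr => s' _; rewrite -[RHS]mulr1 -(pol1 s') mulr_sumr.
      apply: eq_bigr => a _.
      have -> : update w (s', a) (next_stage t') = (s', a) by apply: update_same.
      by rewrite update_other// neq_ltn /= ltnSn orbT.
    by case: (kernelK t' (w (stage_of t')).1 (w (stage_of t')).2).
  subst t; under eq_bigr => s' _.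
    under eq_bigr => a _ do rewrite update_same /=.
    rewrite -mulr_sumr pol1 mulr1; over.
  by rewrite (bigD1 s)//= eqxx big1 ?addr0// => s' /negbTE ->.
Qed.

Lemma expectedB K g h s :
  expected c K pol (fun z => g z - h z) s =
  expected c K pol g s - expected c K pol h s.
Proof. by rewrite -sumrB; apply: eq_bigr => w _; rewrite mulrBr. Qed.

Lemma expectedN K g s :
  expected c K pol (fun z => - g z) s = - expected c K pol g s.
Proof. by rewrite -sumrN; apply: eq_bigr => w _; rewrite mulrN. Qed.

Lemma expected_cst K (b : R) s :
  is_trans_kernel K -> expected c K pol (fun=> b) s = b.
Proof. by move=> ?; rewrite /expected -mulr_suml sum_traj_prob// mul1r. Qed.

Lemma norm_expected_le K g s (b : R) : is_trans_kernel K ->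
  (forall z, 0 <= z <= T.+1%:R -> `|g z| <= b) ->
  `|expected c K pol g s| <= b.
Proof.
move=> kernelK gb; rewrite -(expected_cst b s kernelK).
apply: le_trans (ler_norm_sum _ _ _) _; apply: ler_sum => w _.
rewrite normrM ger0_norm ?traj_prob_ge0//.
by rewrite ler_wpM2l ?traj_prob_ge0// gb// total_cost_itv.
Qed.

End Trajectories.

(** * Random deterministic dynamics *)

(** Jensen via the tangent at the mean [mu]: [expR (f i)] is at least [expR mu * (1 + (f i - mu))],
    and these linear factors average to 1. *)
Lemma expR_mean_le (R : realType) (I : finType) (f : I -> R) :
  (0 < #|I|)%N ->
  expR (#|I|%:R^-1 * \sum_i f i) <= #|I|%:R^-1 * \sum_i expR (f i).
Proof.
move=> I0; set N : R := #|I|%:R; have N0 : 0 < N by rewrite ltr0n.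
set mu := N^-1 * _.
rewrite ler_pdivlMl//.
have Nmu : N * mu = \sum_i f i by rewrite mulVKf ?gt_eqF.
have sum_tangent : \sum_i (1 + (f i - mu)) = N.
  rewrite big_split/= sumrB !sumr_const -[mu *+ _]mulr_natl -/N.
  by rewrite [X in _ - X]Nmu subrr addr0.
rewrite -[X in X * _]sum_tangent mulr_suml; apply: ler_sum => i _.
rewrite -[in leRHS](subrK mu (f i)) expRD.
by rewrite ler_wpM2r ?expR_ge0// expR_ge1Dx.
Qed.

(** Isolates a linear term that vanishes for centred variables. Beyond 1/2, x is below 2x^2; below
    -1/2, [expR x <= 1] suffices; in between, [expR x] is at most 1/(1-x), hence at most
    1+x+2x^2. *)
Lemma expR_le_quadratic (R : realType) (x : R) : expR x <= x + expR (2 * x ^+ 2).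
Proof.
have ge1 := expR_ge1Dx (2 * x ^+ 2).
have [x_small|x_large] := leP x 2^-1; last first.
  apply: (@le_trans _ _ (expR (2 * x ^+ 2))); last by lra.
  by rewrite ler_expR; nra.
have [x_neg|x_pos] := ltP x (- 2^-1).
  have : expR x <= 1 by rewrite -expR0 ler_expR; lra.
  by nra.
have : expR x <= (1 - x)^-1.
  rewrite -[expR x]invrK -expRN lef_pV2 ?posrE ?expR_gt0//; last by lra.
  by rewrite expR_ge1Dx.
have : (1 - x)^-1 <= 1 + x + 2 * x ^+ 2.
  by rewrite -[leLHS]mul1r ler_pdivrMr; [nra|lra].
by lra.
Qed.

(** Hoeffding's lemma with a cruder constant: the linear part of [expR_le_quadratic] has mean
    zero. *)
Lemma mgf_le (R : realType) (D : finType) (q Y : D -> R) (lam B : R) :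
  is_pmf q -> \sum_d q d * Y d = 0 -> (forall d, `|Y d| <= B) ->
  \sum_d q d * expR (lam * Y d) <= expR (2 * (lam * B) ^+ 2).
Proof.
move=> [q0 q1] mean0 YB.
apply: (@le_trans _ _ (\sum_d q d * (lam * Y d + expR (2 * (lam * B) ^+ 2)))).
  apply: ler_sum => d _; rewrite ler_wpM2l//.
  apply: le_trans (expR_le_quadratic _) _; rewrite lerD2l ler_expR.
  rewrite ler_pM2l// !exprMn ler_wpM2l ?sqr_ge0// -[leLHS]real_normK ?num_real//.
  by rewrite lerXn2r ?nnegrE// (le_trans _ (YB d)).
under eq_bigr => d _ do rewrite mulrDr mulrCA.
by rewrite big_split/= -mulr_sumr mean0 mulr0 add0r -mulr_suml q1 mul1r.
Qed.

Section Dynamics.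
Variables (R : realType) (T : nat) (S A : nat -> finType).

Definition decision : finType := {t : 'I_T & (S t * A t)%type}.

(** A full table of next states: the randomness of all transitions drawn in advance, after which the
    system evolves deterministically given the actions. *)
Definition dynamics : finType := {dffun forall u : decision, S (tag u).+1}.

Definition decide (t : 'I_T) (y : (S t * A t)%type) : decision :=
  Tagged (fun t : 'I_T => (S t * A t)%type) y.

Definition dynamics_kernel (D : dynamics) : trans_kernel R T S A :=
  fun t s a s' => (D (decide (s, a)) == s' :> S t.+1)%:R.

Definition dynamics_prob (K : trans_kernel R T S A) (D : dynamics) : R :=
  \prod_(u : decision) K (tag u) (tagged u).1 (tagged u).2 (D u).

Lemma dynamics_prob_pmf (K : trans_kernel R T S A) :
  is_trans_kernel K -> is_pmf (dynamics_prob K).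
Proof.
move=> kernelK; split.
  by move=> D; apply: prodr_ge0 => u _;
    case: (kernelK (tag u) (tagged u).1 (tagged u).2).
rewrite /dynamics_prob.
rewrite (sum_dffun_prod (fun u : decision => K (tag u) (tagged u).1 (tagged u).2)).
by apply: big1 => u _; case: (kernelK (tag u) (tagged u).1 (tagged u).2).
Qed.

Lemma dynamics_kernelP (D : dynamics) : is_trans_kernel (dynamics_kernel D).
Proof.
move=> t s a; split=> [s'|]; first exact: ler0n.
rewrite (bigD1 (D (decide (s, a)) : S t.+1))//= /dynamics_kernel eqxx big1 ?addr0//.
by move=> s'; rewrite eq_sym => /negbTE ->.
Qed.

(** Reduces a product over all table entries to those that a trajectory visits, one per stage. *)
Lemma prod_decision (v : forall t : 'I_T, (S t * A t)%type) (f : decision -> R) :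
  (forall u : decision, tagged u != v (tag u) -> f u = 1) ->
  \prod_(u : decision) f u = \prod_(t < T) f (decide (v t)).
Proof.
move=> f1.
transitivity (\prod_(t : 'I_T) \prod_(y : (S t * A t)%type) f (decide y)).
  by rewrite sig_big_dep; apply: eq_bigr => -[t y].
apply: eq_bigr => t _; rewrite (bigD1 (v t))//= big1 ?mulr1// => y yv.
exact: f1.
Qed.

(* Along a trajectory every stage is visited once, so distinct coordinates of
   the random dynamics are used, and these are independent. *)
Lemma expected_dynamics (c : costs R T S A) (pol : policy R T S A)
    (K : trans_kernel R T S A) (g : R -> R) (s : S 0%N) :
  is_trans_kernel K ->
  \sum_D dynamics_prob K D * expected c (dynamics_kernel D) pol g s =
  expected c K pol g s.
Proof.
move=> kernelK.
under eq_bigr => D _ do rewrite mulr_sumr.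
rewrite exchange_big/=; apply: eq_bigr => w _.
under eq_bigr => D _ do rewrite mulrA.
rewrite -mulr_suml; congr (_ * _).
under eq_bigr => D _ do rewrite /traj_prob mulrCA.
rewrite -mulr_sumr; congr (_ * _).
(* An entry is tested only if the trajectory [w] visits it; elsewhere the factor is 1, so the kernel
   simply sums to 1 there. *)
pose hit (u : decision) (y : S (tag u).+1) : R :=
  if tagged u == w (stage_of (tag u)) then
    (y == (w (next_stage (tag u))).1 :> S (tag u).+1)%:R else 1.
transitivity (\sum_(D : dynamics) \prod_u
    (K (tag u) (tagged u).1 (tagged u).2 (D u) * hit u (D u))).
  apply: eq_bigr => D _; rewrite big_split/=; congr (_ * _).
  rewrite (@prod_decision (fun t => w (stage_of t))); last first.
    by move=> u /negbTE uw; rewrite /hit uw.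
  apply: eq_bigr => t _; rewrite /dynamics_kernel /hit /= eqxx.
  by case: (w (stage_of t)).
rewrite (sum_dffun_prod
  (fun u y => K (tag u) (tagged u).1 (tagged u).2 y * hit u y)).
rewrite (@prod_decision (fun t => w (stage_of t))); last first.
  move=> u /negbTE uw; rewrite /hit uw; under eq_bigr => y _ do rewrite mulr1.
  by case: (kernelK (tag u) (tagged u).1 (tagged u).2).
apply: eq_bigr => t _; rewrite /hit /= eqxx.
rewrite (bigD1 ((w (next_stage t)).1 : S t.+1))//= eqxx mulr1 big1 ?addr0//.
by move=> y /negbTE ->; rewrite mulr0.
Qed.

End Dynamics.

(** * Cyclic shifts and concentration of the averaged kernel *)

Section Averaging.
Variables (R : realType) (T : nat) (S A : nat -> finType) (m : nat).
Implicit Types (D : {ffun 'I_m.+1 -> dynamics T S A}).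
Implicit Types (J : {ffun 'I_T -> 'I_m.+1}).

Definition average_kernel D : trans_kernel R T S A := fun t s a s' =>
  m.+1%:R^-1 * \sum_(i < m.+1) dynamics_kernel R (D i) s a s'.

(** Addition is modulo [m.+1]. For fixed [J], distinct i use distinct samples at every stage, so the
    shifted dynamics share no sample and remain independent. *)
Definition shift J D : {ffun 'I_m.+1 -> dynamics T S A} :=
  [ffun i => [ffun u : decision T S A => D (i + J (tag u)) u]].

Lemma card_shifts_gt0 : (0 < #|{ffun 'I_T -> 'I_m.+1}|)%N.
Proof. by rewrite card_ffun !card_ord expn_gt0. Qed.

Lemma shift_inj J : injective (shift J).
Proof.
move=> D D' /ffunP eqD; apply/ffunP => i; apply/ffunP => u.
have := eqD (i - J (tag u)); rewrite !ffunE => /ffunP /(_ u).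
by rewrite !ffunE subrK.
Qed.

Lemma average_kernelP D : is_trans_kernel (average_kernel D).
Proof.
move=> t s a; split=> [s'|].
  by rewrite mulr_ge0// ?invr_ge0// sumr_ge0// => i _; exact: ler0n.
rewrite -mulr_sumr exchange_big/=.
under eq_bigr => i _ do rewrite (dynamics_kernelP R (D i) s a).2.
by rewrite sumr_const card_ord mulVf.
Qed.

(* The empirical expectation is a multi-sample U-statistic; cyclic shifts turn
   it into an average of means over independent dynamics (Hoeffding). *)
Lemma expected_average (c : costs R T S A) (pol : policy R T S A) D
    (g : R -> R) (s : S 0%N) :
  expected c (average_kernel D) pol g s =
  #|{ffun 'I_T -> 'I_m.+1}|%:R^-1 * \sum_J (m.+1%:R^-1 *
    \sum_(i < m.+1) expected c (dynamics_kernel R (shift J D i)) pol g s).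
Proof.
rewrite -mulr_sumr; under [in RHS]eq_bigr => J _ do rewrite exchange_big/=.
rewrite exchange_big/= !mulr_sumr; apply: eq_bigr => w _.
(* The transition factor of [w] when stage t follows dynamics [J t]. Expanding the product of
   averaged kernels gives the mean of [f] over all [J]. *)
pose f J : R := \prod_(t < T) dynamics_kernel R (D (J t))
  (w (stage_of t)).1 (w (stage_of t)).2 (w (next_stage t)).1.
have shiftf J (i : 'I_m.+1) : traj_prob c (dynamics_kernel R (shift J D i)) pol w =
    (\prod_(t < T.+1) pol t (w t).1 (past_cost c w t) (w t).2) *
    f [ffun t => i + J t].
  by congr (_ * _); apply: eq_bigr => t _; rewrite /dynamics_kernel !ffunE.
under [in RHS]eq_bigr => J _ do under eq_bigr => i _ do rewrite shiftf.
under [in RHS]eq_bigr => J _ do rewrite -mulr_suml -mulr_sumr.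
rewrite -mulr_suml -mulr_sumr exchange_big/=.
(* Translation by i permutes the choices [J], so every i contributes the same sum. *)
have shift_sum (i : 'I_m.+1) :
    \sum_(J : {ffun 'I_T -> 'I_m.+1}) f [ffun t => i + J t] = \sum_J f J.
  rewrite [RHS](reindex (fun J : {ffun 'I_T -> 'I_m.+1} => [ffun t => i + J t])) //=.
  exists (fun J : {ffun 'I_T -> 'I_m.+1} => [ffun t => J t - i]) => J _;
    apply/ffunP => t.
    by rewrite !ffunE addrC addKr.
  by rewrite !ffunE addrC subrK.
rewrite [X in _ * X * g _](eq_bigr (fun=> \sum_J f J)) => [|i _]; last exact: shift_sum.
rewrite sumr_const card_ord -[_ *+ m.+1]mulr_natl /traj_prob.
rewrite (_ : \prod_(t < T) _ = (#|{ffun 'I_T -> 'I_m.+1}|%:R)^-1 * \sum_J f J).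
  by field; rewrite nat1r !pnatr_eq0 -!lt0n card_shifts_gt0.
rewrite big_split/= prodr_const card_ord card_ffun !card_ord natrX exprVn.
by congr (_ * _); rewrite bigA_distr_bigA.
Qed.

Variables (K : trans_kernel R T S A) (kernelK : is_trans_kernel K).

Definition samples_prob D : R := \prod_(i < m.+1) dynamics_prob K (D i).

Lemma samples_prob_ge0 D : 0 <= samples_prob D.
Proof. by apply: prodr_ge0 => i _; case: (dynamics_prob_pmf kernelK). Qed.

(** At each table entry the shift only permutes the sample indices, and the product law is symmetric
    in them. *)
Lemma samples_prob_shift J D : samples_prob (shift J D) = samples_prob D.
Proof.
rewrite /samples_prob /dynamics_prob exchange_big [RHS]exchange_big /=.
apply: eq_bigr => u _.
rewrite [RHS](reindex (fun i => i + J (tag u)))/=.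
  by apply: eq_bigr => i _; rewrite !ffunE.
by exists (fun i => i - J (tag u)) => i _; rewrite (addrK, subrK).
Qed.

(** Jensen moves the exponential inside the average over [J]. By shift invariance each [J] then
    contributes the moment generating function of a plain mean of [m.+1] independent copies, which
    factorizes. *)
Lemma mgf_samples_le (Y : dynamics T S A -> R) (lam B : R) :
  \sum_d dynamics_prob K d * Y d = 0 -> (forall d, `|Y d| <= B) ->
  \sum_D samples_prob D * expR (lam * (#|{ffun 'I_T -> 'I_m.+1}|%:R^-1 *
    \sum_J (m.+1%:R^-1 * \sum_(i < m.+1) Y (shift J D i)))) <=
  expR (2 * (lam * B) ^+ 2 / m.+1%:R).
Proof.
move=> mean0 YB; set N := #|_|; have N0 : (0 < N)%N := card_shifts_gt0.
apply: (@le_trans _ _ (\sum_D samples_prob D * (N%:R^-1 * \sum_J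
    expR (lam * (m.+1%:R^-1 * \sum_(i < m.+1) Y (shift J D i)))))).
  apply: ler_sum => D _; rewrite ler_wpM2l ?samples_prob_ge0//.
  by rewrite mulrCA mulr_sumr expR_mean_le.
under eq_bigr => D _ do rewrite mulrCA mulr_sumr.
rewrite -mulr_sumr exchange_big/= ler_pdivrMl ?ltr0n//.
suff le_expR J : \sum_D samples_prob D *
    expR (lam * (m.+1%:R^-1 * \sum_(i < m.+1) Y (shift J D i))) <=
    expR (2 * (lam * B) ^+ 2 / m.+1%:R).
  apply: le_trans (ler_sum _ (fun J _ => le_expR J)) _.
  by rewrite sumr_const -[leLHS]mulr_natl.
set mu := lam / m.+1%:R.
have -> : \sum_D samples_prob D *
    expR (lam * (m.+1%:R^-1 * \sum_(i < m.+1) Y (shift J D i))) =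
    \sum_(D : {ffun 'I_m.+1 -> dynamics T S A})
      \prod_(i < m.+1) (dynamics_prob K (D i) * expR (mu * Y (D i))).
  rewrite [RHS](reindex (shift J)) /=; last exact/onW_bij/injF_bij/shift_inj.
  apply: eq_bigr => D _; rewrite big_split /= -/(samples_prob _).
  by rewrite samples_prob_shift mulrA -/mu mulr_sumr expR_sum.
rewrite -(bigA_distr_bigA (fun=> fun d => dynamics_prob K d * expR (mu * Y d))).
rewrite prodr_const card_ord.
apply: (@le_trans _ _ (expR (2 * (mu * B) ^+ 2) ^+ m.+1)).
  rewrite lerXn2r ?nnegrE ?expR_ge0//; last exact: mgf_le (dynamics_prob_pmf _) _ _.
  apply: sumr_ge0 => d _; rewrite mulr_ge0 ?expR_ge0//.
  by case: (dynamics_prob_pmf kernelK).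
rewrite -expRM_natl ler_expR le_eqVlt; apply/orP; left; apply/eqP.
by rewrite /mu; field; rewrite nat1r pnatr_eq0.
Qed.

Lemma sum_samples_prob : \sum_D samples_prob D = 1.
Proof.
rewrite /samples_prob -(bigA_distr_bigA (fun=> dynamics_prob K)).
by apply: big1 => i _; case: (dynamics_prob_pmf kernelK).
Qed.

Variables (c : costs R T S A) (pol : policy R T S A).
Hypotheses (cost_c : is_cost c) (policy_pol : is_policy pol).

Lemma expected_upper_tail (g : R -> R) (s : S 0%N) (B eta : R) :
  0 < B -> 0 < eta -> (forall z, 0 <= z <= T.+1%:R -> `|g z| <= B) ->
  \sum_(D | eta < expected c (average_kernel D) pol g s - expected c K pol g s)
    samples_prob D <= expR (- (eta ^+ 2 * m.+1%:R / (32 * B ^+ 2))).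
Proof.
move=> B0 eta0 gB; set V := expected c K pol g s.
pose Y d := expected c (dynamics_kernel R d) pol g s - V.
have [q0 q1] := dynamics_prob_pmf kernelK.
have mean0 : \sum_d dynamics_prob K d * Y d = 0.
  under eq_bigr => d _ do rewrite mulrBr.
  by rewrite sumrB expected_dynamics// -mulr_suml q1 mul1r subrr.
have YB d : `|Y d| <= 2 * B.
  rewrite mulr_natl mulr2n; apply: le_trans (ler_normB _ _) _.
  by rewrite lerD// norm_expected_le//; exact: dynamics_kernelP.
have devE D : expected c (average_kernel D) pol g s - V =
    #|{ffun 'I_T -> 'I_m.+1}|%:R^-1 *
    \sum_J (m.+1%:R^-1 * \sum_(i < m.+1) Y (shift J D i)).
  rewrite expected_average.
  under [in RHS]eq_bigr => J _ do
    rewrite sumrB sumr_const card_ord -[V *+ _]mulr_natl mulrBr mulKf//.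
  rewrite sumrB sumr_const -[V *+ _]mulr_natl mulrBr mulKf//.
  by rewrite pnatr_eq0 -lt0n card_shifts_gt0.
(* Minimizes the Chernoff exponent -lam eta + 8 lam^2 B^2 / (m+1); the 8 comes from the centred
   range 2B. The minimum is -eta^2 (m+1) / (32 B^2). *)
pose lam := eta * m.+1%:R / (16 * B ^+ 2).
have lam0 : 0 < lam by rewrite divr_gt0 ?mulr_gt0 ?exprn_gt0.
apply: (@le_trans _ _ (expR (- (lam * eta)) * \sum_D samples_prob D *
    expR (lam * (expected c (average_kernel D) pol g s - V)))).
  rewrite mulr_sumr big_mkcond/=; apply: ler_sum => D _.
  case: ifP => [dev|_]; last first.
    by rewrite mulr_ge0 ?mulr_ge0 ?expR_ge0 ?samples_prob_ge0.
  rewrite mulrCA -expRD -[leLHS]mulr1 ler_wpM2l ?samples_prob_ge0//.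
  by rewrite -expR0 ler_expR addrC subr_ge0 ler_wpM2l ?ltW.
under eq_bigr => D _ do rewrite devE.
apply: le_trans (ler_wpM2l (expR_ge0 _) (mgf_samples_le _ mean0 YB)) _.
rewrite -expRD ler_expR le_eqVlt; apply/orP; left; apply/eqP.
rewrite /lam; field.
by rewrite gt_eqF// nat1r pnatr_eq0.
Qed.

Lemma expected_tail (g : R -> R) (s : S 0%N) (B eta : R) :
  0 < B -> 0 < eta -> (forall z, 0 <= z <= T.+1%:R -> `|g z| <= B) ->
  \sum_(D |
      eta < `|expected c (average_kernel D) pol g s - expected c K pol g s|)
    samples_prob D <= 2 * expR (- (eta ^+ 2 * m.+1%:R / (32 * B ^+ 2))).
Proof.
move=> B0 eta0 gB; rewrite mulr_natl mulr2n.
have NgB z : 0 <= z <= T.+1%:R -> `|- g z| <= B by rewrite normrN; exact: gB.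
apply: le_trans (lerD (expected_upper_tail s B0 eta0 gB)
  (expected_upper_tail s B0 eta0 NgB)).
rewrite [X in _ <= X + _]big_mkcond [X in _ <= _ + X]big_mkcond -big_split.
rewrite [leLHS]big_mkcond /=.
apply: ler_sum => D _; rewrite !expectedN -opprD lter_normr.
have := samples_prob_ge0 D; case: (eta < _ - _); case: (eta < - _) => /= p0.
- by rewrite lerDl.
- by rewrite addr0.
- by rewrite add0r.
- by rewrite addr0.
Qed.

End Averaging.

(** * Euclidean nets *)

(** The full series is 1/(1-x) with x = [expR (- rho^-1)], and 1/x is at least 1 + 1/rho. *)
Lemma geometric_sum_le (R : realType) (rho : R) (N : nat) : 0 < rho ->
  \sum_(i < N) expR (- rho^-1) ^+ i <= 1 + rho.
Proof.
move=> rho0; set x := expR _.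
have x0 : 0 <= x := expR_ge0 _.
have x1 : x * (1 + rho) <= rho.
  have : 1 + rho^-1 <= x^-1 by rewrite -expRN opprK expR_ge1Dx.
  move=> /(ler_wpM2l x0); rewrite divff ?gt_eqF ?expR_gt0// => xle.
  rewrite -[leRHS]mul1r; apply: le_trans (ler_wpM2r (ltW rho0) xle).
  by rewrite -mulrA mulrDl mulVf ?gt_eqF// mul1r addrC.
have sum_le : (1 - x) * \sum_(i < N) x ^+ i <= 1.
  by rewrite -opprB mulNr -subrX1 opprB gerBl exprn_ge0.
have : 1 <= (1 - x) * (1 + rho) by lra.
have x_lt1 : 0 < 1 - x by nra.
by move=> /(le_trans sum_le); rewrite ler_pM2l.
Qed.

(* Exponential weights: 1 <= exp (k - (sum of the entries) / rho) on the set
   that is counted. *)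
Lemma card_small_signed_vectors (R : realType) (k N : nat) (rho : R) : 0 < rho ->
  #|[set z : {ffun 'I_k -> bool * 'I_N} |
      (\sum_i (z i).2%:R <= k%:R * rho)%R]%SET|%:R <=
    (2 * expR 1 * (1 + rho)) ^+ k.
Proof.
move=> rho0; set x := expR (- rho^-1).
apply: (@le_trans _ _ (\sum_(z : {ffun 'I_k -> bool * 'I_N})
    \prod_(i < k) (expR 1 * x ^+ (z i).2))).
  rewrite -sum1_card natr_sum big_mkcond/=; apply: ler_sum => z _; rewrite inE.
  case: ifP => [small|_]; last first.
    by apply: prodr_ge0 => i _; rewrite mulr_ge0 ?exprn_ge0 ?expR_ge0.
  have -> : \prod_(i < k) (expR 1 * x ^+ (z i).2) =
      expR (k%:R - (\sum_i (z i).2%:R) / rho).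
    rewrite big_split prodr_const card_ord -expRM_natl mulr1 expRD; congr (_ * _).
    rewrite mulr_suml -sumrN expR_sum; apply: eq_bigr => i _.
    by rewrite -expRM_natl mulrN.
  rewrite -[leLHS]expR0 ler_expR subr_ge0 ler_pdivrMr//.
rewrite -(bigA_distr_bigA (fun=> fun y : bool * 'I_N => expR 1 * x ^+ y.2)).
rewrite prodr_const card_ord lerXn2r ?nnegrE//.
- by apply: sumr_ge0 => y _; rewrite mulr_ge0 ?exprn_ge0 ?expR_ge0.
- by rewrite !mulr_ge0 ?expR_ge0// addr_ge0// ltW.
rewrite -mulr_sumr [2 * _]mulrC -mulrA ler_wpM2l ?expR_ge0//.
rewrite -(pair_bigA _ (fun (b : bool) (i : 'I_N) => x ^+ i))/= big_bool /=.
by rewrite -mulr2n -[leLHS]mulr_natl ler_wpM2l// geometric_sum_le.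
Qed.

Lemma truncn_eq_dist (R : realType) (a b h : R) : 0 < h ->
  (a < 0) = (b < 0) ->
  Num.truncn (`|a| / h) = Num.truncn (`|b| / h) -> `|a - b| <= h.
Proof.
move=> h0 sgn_eq trunc_eq.
have dist : `| `|a| - `|b| | <= h.
  have /andP[] := truncn_itv (divr_ge0 (normr_ge0 a) (ltW h0)).
  have /andP[] := truncn_itv (divr_ge0 (normr_ge0 b) (ltW h0)).
  rewrite -trunc_eq; set m := Num.truncn _.
  rewrite !ler_pdivlMr// !ltr_pdivrMr// -natr1 mulrDl mul1r => *.
  by rewrite ler_norml; apply/andP; split; lra.
move: dist; case: (ltP a 0) sgn_eq => [a0 /esym b0|a0 /esym/negbT].
  by rewrite (ltr0_norm a0) (ltr0_norm b0) -opprD normrN.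
by rewrite -leNgt => b0; rewrite (ger0_norm a0) (ger0_norm b0).
Qed.

Lemma norm2_sqr (R : realType) (k : nat) (v : 'rV[R]_k) :
  norm2 v ^+ 2 = \sum_i v ord0 i ^+ 2.
Proof. by rewrite sqr_sqrtr// sumr_ge0// => i _; exact: sqr_ge0. Qed.

Lemma norm2_ge0 (R : realType) (k : nat) (v : 'rV[R]_k) : 0 <= norm2 v.
Proof. exact: sqrtr_ge0. Qed.

(* The net is obtained by rounding each coordinate to a multiple of
   r / sqrt k; AM-GM bounds the l^1 norm of the rounded points, which
   keeps the constant independent of the dimension. *)
Lemma euclidean_net (R : realType) (k : nat) (Theta : set 'rV[R]_k)
    (center : 'rV[R]_k) (r rho : R) :
  Theta !=set0 -> 0 < r -> 0 < rho ->
  (forall theta, Theta theta -> norm2 (theta - center) <= rho * r) ->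
  exists (I : finType) (net : I -> 'rV[R]_k),
    [/\ #|I|%:R <= (2 * expR 1 * (1 + rho)) ^+ k,
        forall i, Theta (net i)
      & forall theta, Theta theta -> exists i, norm2 (theta - net i) <= r].
Proof.
move=> [theta0 Theta0] r0 rho0 ball.
(* Cells of side h have Euclidean diameter r. In dimension 0 this h is 0 by the convention on
   division, so facts about it are stated under some [i : 'I_k]. *)
pose h := r / Num.sqrt k%:R.
pose level (theta : 'rV[R]_k) i := Num.truncn (`|(theta - center) ord0 i| / h).
pose N := Num.truncn (k%:R * rho).
pose code theta : {ffun 'I_k -> bool * 'I_N.+1} :=
  [ffun i => ((theta - center) ord0 i < 0, inord (level theta i))].
have h0 (i : 'I_k) : 0 < h.
  by rewrite divr_gt0// sqrtr_gt0 ltr0n (leq_ltn_trans _ (ltn_ord i)).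
have kh2 (i : 'I_k) : k%:R * h ^+ 2 = r ^+ 2.
  have k0 : (0 < k)%N by rewrite (leq_ltn_trans _ (ltn_ord i)).
  rewrite expr_div_n sqr_sqrtr ?ler0n// mulrCA divff ?mulr1//.
  by rewrite pnatr_eq0 -lt0n.
have level_sum theta : Theta theta -> \sum_i (level theta i)%:R <= k%:R * rho.
  move=> Ttheta.
  apply: (@le_trans _ _ (\sum_i (((theta - center) ord0 i / h) ^+ 2 / rho + rho) / 2)).
    apply: ler_sum => i _.
    have /andP[+ _] := truncn_itv
      (divr_ge0 (normr_ge0 ((theta - center) ord0 i)) (ltW (h0 i))).
    move=> /le_trans; apply.
    rewrite -(real_normK (num_real ((theta - center) ord0 i / h))) normrM.
    rewrite normfV (gtr0_norm (h0 i)); set a := `|_| / h.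
    rewrite ler_pdivlMr// -subr_ge0.
    have -> : a ^+ 2 / rho + rho - a * 2 = (a - rho) ^+ 2 / rho.
      by field; rewrite gt_eqF.
    by rewrite divr_ge0 ?sqr_ge0// ltW.
  rewrite -mulr_suml big_split/= -mulr_suml sumr_const card_ord -[rho *+ k]mulr_natl.
  rewrite ler_pdivrMr// mulr_natr mulr2n lerD2r ler_pdivrMr// -mulrA -expr2.
  have [k0|k0] := posnP k.
    rewrite big1 => [|i _]; first by rewrite mulr_ge0 ?sqr_ge0 ?ler0n.
    by have := ltn_ord i; rewrite [X in (_ < X)%N]k0.
  have i0 : 'I_k := Ordinal k0.
  under eq_bigr => i _ do rewrite expr_div_n.
  rewrite -mulr_suml -norm2_sqr ler_pdivrMr ?exprn_gt0 ?(h0 i0)//.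
  rewrite mulrAC (kh2 i0) mulrC -exprMn lerXn2r ?nnegrE ?norm2_ge0 ?ball//.
  by rewrite mulr_ge0 ?ltW.
have code_lt theta i : Theta theta -> (level theta i < N.+1)%N.
  move=> /level_sum le_k; rewrite ltnS truncn_ge_nat; last first.
    by rewrite mulr_ge0 ?ler0n ?ltW.
  apply: le_trans le_k; rewrite (bigD1 i)//= lerDl.
  by apply: sumr_ge0 => j _; exact: ler0n.
pose cells := [set z : {ffun 'I_k -> bool * 'I_N.+1} |
  (\sum_i (z i).2%:R <= k%:R * rho)%R]%SET.
have code_cells theta : Theta theta -> code theta \in cells.
  move=> Ttheta; rewrite inE; under eq_bigr => i _ do
    rewrite ffunE /= inordK ?code_lt//.
  exact: level_sum.
pose I : finType := {z | z \in cells}.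
(* Each cell met by [Theta] is represented by one of its own points, so the net stays inside
   [Theta]; the other cells get the default [theta0]. *)
pose net (z : I) : 'rV[R]_k :=
  if pselect (exists theta, Theta theta /\ code theta = sval z) is left ex
  then sval (cid ex) else theta0.
exists I, net; split.
- rewrite card_sig; exact: card_small_signed_vectors.
- by move=> z; rewrite /net; case: pselect => // ex; case: (cid ex) => ? [].
- move=> theta Ttheta; exists (exist (fun z => z \in cells) _ (code_cells _ Ttheta)).
  rewrite /net; case: pselect => [ex|[]]; last by exists theta.
  case: (cid ex) => theta' /= [Ttheta' /ffunP eq_code].
  rewrite -(ler_pXn2r (n := 2)) ?nnegrE ?norm2_ge0 ?(ltW r0)// norm2_sqr.
  have close i : `|(theta - theta') ord0 i| <= h.
    have := eq_code i; rewrite !ffunE => -[sgn_eq /(congr1 val)].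
    rewrite /= !inordK ?code_lt// => trunc_eq.
    have -> : (theta - theta') ord0 i =
        (theta - center) ord0 i - (theta' - center) ord0 i.
      by rewrite !mxE; ring.
    exact: truncn_eq_dist (h0 i) (esym sgn_eq) (esym trunc_eq).
  have [k0|k0] := posnP k.
    rewrite big1 ?sqr_ge0// => i _.
    by have := ltn_ord i; rewrite [X in (_ < X)%N]k0.
  rewrite -(kh2 (Ordinal k0)) mulr_natl -[X in _ *+ X]card_ord -sumr_const.
  apply: ler_sum => i _; rewrite -real_normK ?num_real//.
  by rewrite lerXn2r ?nnegrE// (le_trans _ (close i)).
Qed.

(** * Law of the samples and union bound *)

Lemma probability_finite_event (R : realType) (d : measure_display)
    (Omega : measurableType d) (P : probability Omega R) (Y : finType)
    (Z : Omega -> Y) (p : Y -> R) (E : pred Y) :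
  (forall y, measurable (Z @^-1` [set y])) ->
  (forall y, P (Z @^-1` [set y]) = (p y)%:E) ->
  P [set w | E (Z w)] = (\sum_(y | E y) p y)%:E.
Proof.
move=> measZ lawZ.
have law_seq (r : seq Y) : uniq r -> measurable [set w | Z w \in r] /\
    P [set w | Z w \in r] = (\sum_(y <- r) p y)%:E.
  elim: r => [_|y r IHr /= /andP[y_r uniq_r]].
    have -> : [set w | Z w \in [::]] = set0 by apply/seteqP; split.
    by rewrite measure0 big_nil.
  have [meas_r law_r] := IHr uniq_r.
  have -> : [set w | Z w \in y :: r] = Z @^-1` [set y] `|` [set w | Z w \in r].
    apply/seteqP; split=> w /=; rewrite in_cons.
      by case/orP => [/eqP|]; [left|right].
    by case=> [->|->]; rewrite ?eqxx ?orbT.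
  split; first exact: measurableU.
  rewrite measureU//; last first.
    apply/seteqP; split=> // w [/= Zwy]; rewrite Zwy => y_in.
    by rewrite y_in in y_r.
  by rewrite big_cons EFinD; congr (_ + _)%E; [exact: lawZ|exact: law_r].
have [_ law_E] := law_seq (enum E) (enum_uniq E).
rewrite big_enum in law_E; rewrite -law_E; congr (P _).
by apply/seteqP; split=> w /=; rewrite mem_enum.
Qed.

Section Sampling.
Variables (R : realType) (T : nat) (S A : nat -> finType) (m : nat).
Variables (d : measure_display) (Omega : measurableType d).
Variables (P : probability Omega R) (X : sample_family T S A m.+1 Omega).

Definition sampled_dynamics (w : Omega) : {ffun 'I_m.+1 -> dynamics T S A} :=
  [ffun i => [ffun u : decision T S A =>
    X (sample_idx (tagged u).1 (tagged u).2 i) w : S (tag u).+1]].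

Lemma empiricalE (w : Omega) (t : 'I_T) (s : S t) (a : A t) (s' : S t.+1) :
  empirical R X w t s a s' = average_kernel R (sampled_dynamics w) s a s'.
Proof.
rewrite /empirical /average_kernel mulrC -sum1_card natr_sum big_mkcond/=.
congr (_ * _); apply: eq_bigr => i _.
by rewrite inE /dynamics_kernel !ffunE /=; case: eqP.
Qed.

(** Prescribing all the dynamics prescribes every sample, so the event is an intersection over all
    sample indices; mutual independence gives a product, regrouped by dynamics. *)
Lemma sampled_dynamics_law (K : trans_kernel R T S A) :
  is_sampling K P X -> forall D,
  measurable (sampled_dynamics @^-1` [set D]) /\
  P (sampled_dynamics @^-1` [set D]) = (samples_prob K D)%:E.
Proof.
move=> [measX lawX indepX] D.
pose B (j : sample_index T S A m.+1) : set (S (tag j).+1) :=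
  [set (D (tagged j).2 (decide (tagged j).1) : S (tag j).+1)].
have eventE : sampled_dynamics @^-1` [set D] =
    \bigcap_(j in [set` [set: sample_index T S A m.+1]%SET]) (X j @^-1` B j).
  apply/seteqP; split=> w /=.
    move=> Dw [t [[s a] i]] _ /=; rewrite /B /= -Dw !ffunE; reflexivity.
  move=> capw; apply/ffunP => i; apply/ffunP => -[t [s a]]; rewrite !ffunE /=.
  by apply: (capw (sample_idx s a i)); rewrite /= inE.
split.
  rewrite eventE; apply: fin_bigcap_measurable; last by move=> j _; exact: measX.
  exact: finite_finset.
rewrite eventE indepX.
transitivity (\prod_(j : sample_index T S A m.+1)
  (K (tag j) (tagged j).1.1 (tagged j).1.2
    (D (tagged j).2 (decide (tagged j).1)))%:E)%E.
  apply: eq_big => [j|[t [[s a] i]] _]; first by rewrite inE.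
  exact: lawX.
rewrite prodEFin; congr (_%:E).
rewrite /samples_prob /dynamics_prob exchange_big/=.
transitivity (\prod_(t : 'I_T) \prod_(y : (S t * A t * 'I_m.+1)%type)
    K t y.1.1 y.1.2 (D y.2 (decide y.1))).
  by rewrite sig_big_dep; apply: eq_bigr => -[t y].
transitivity (\prod_(t : 'I_T) \prod_(y : (S t * A t)%type) \prod_(i < m.+1)
    K t y.1 y.2 (D i (decide y))).
  by apply: eq_bigr => t _; rewrite pair_bigA.
by rewrite sig_big_dep; apply: eq_bigr => -[t y].
Qed.

End Sampling.

(** * Parameter net, comparison of risks, and constants *)

Lemma inf_image_le (R : realType) (I : Type) (Theta : set I) (u v : I -> R)
    (b : R) : Theta !=set0 -> has_lbound [set u theta | theta in Theta] ->
  (forall theta, Theta theta -> u theta <= v theta + b) ->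
  inf [set u theta | theta in Theta] <= inf [set v theta | theta in Theta] + b.
Proof.
move=> [theta0 Theta0] lbu uv; rewrite -lerBlDr; apply: lb_le_inf.
  by exists (v theta0), theta0.
move=> _ [theta Ttheta <-]; rewrite lerBlDr; apply: le_trans (uv _ Ttheta).
by apply: ge_inf => //; exists theta.
Qed.

Lemma inf_image_dist (R : realType) (I : Type) (Theta : set I) (u v : I -> R)
    (b : R) : Theta !=set0 -> has_lbound [set u theta | theta in Theta] ->
  has_lbound [set v theta | theta in Theta] ->
  (forall theta, Theta theta -> `|u theta - v theta| <= b) ->
  `|inf [set u theta | theta in Theta] - inf [set v theta | theta in Theta]|
    <= b.
Proof.
move=> Theta0 lbu lbv uv.
have uv_le : inf [set u theta | theta in Theta] <=
    inf [set v theta | theta in Theta] + b.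
  apply: inf_image_le => // theta /uv; rewrite ler_norml => /andP[_].
  by rewrite lerBlDl.
have vu_le : inf [set v theta | theta in Theta] <=
    inf [set u theta | theta in Theta] + b.
  apply: inf_image_le => // theta /uv; rewrite distrC ler_norml => /andP[_].
  by rewrite lerBlDl.
by rewrite ler_norml; apply/andP; split; lra.
Qed.

(** The maxima with [LC], [Lpi] and [eps^-1] contribute 2 each and T^4 at least 1; the remaining
    factors are those of the union bound. *)
Lemma log_argument_ge (R : realType) (T cardS k : nat)
    (LC Lpi LTheta RTheta eps delta : R) : (0 < T)%N -> 0 < delta ->
  8 * cardS%:R * Num.max (LTheta * RTheta / eps) 2 ^+ k / delta <=
    log_argument T cardS k LC Lpi LTheta RTheta eps delta.
Proof.
move=> T0 delta0; rewrite /log_argument ler_wpM2r ?invr_ge0 ?(ltW delta0)//.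
have ge2 (x : R) : 2 <= Num.max x 2 by rewrite le_max lexx orbT.
have T4 : 1 <= T%:R ^+ 4 :> R by rewrite exprn_ege1// ler1n.
have ? := ge2 LC; have ? := ge2 Lpi; have ? := ge2 eps^-1.
have M0 : 0 <= cardS%:R * Num.max (LTheta * RTheta / eps) 2 ^+ k.
  by rewrite mulr_ge0// exprn_ge0// (le_trans _ (ge2 _)).
rewrite [leRHS](_ : _ = (T%:R ^+ 4 * Num.max LC 2 * Num.max Lpi 2 *
  Num.max eps^-1 2) * (cardS%:R * Num.max (LTheta * RTheta / eps) 2 ^+ k));
  last by ring.
rewrite -mulrA ler_wpM2r//.
have -> : 8 = 1 * 2 * 2 * 2 :> R by ring.
by rewrite !ler_pM// ?mulr_ge0.
Qed.

Lemma expR1_le4 (R : realType) : expR 1 <= 4 :> R.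
Proof.
have half : expR (2^-1) <= 2 :> R.
  rewrite -[leLHS]invrK -expRN -[leRHS]invrK lef_pV2 ?posrE ?expR_gt0//.
  by apply: le_trans (expR_ge1Dx _); lra.
have -> : expR 1 = expR 2^-1 * expR 2^-1 :> R.
  by rewrite -expRD; congr expR; field.
have -> : 4 = 2 * 2 :> R by ring.
by rewrite ler_pM ?expR_ge0.
Qed.

(** A Euclidean net of radius eps/(4 LTheta) moves [f] by at most eps/4. Relative to this radius
    [Theta] has size at most 4M, which [euclidean_net] converts into a cardinality. *)
Lemma parameter_net (R : realType) (k : nat) (Theta : set 'rV[R]_k)
    (f : 'rV[R]_k -> R -> R) (Z : set R) (LTheta RTheta eps : R) :
  Theta !=set0 -> 0 < eps ->
  (forall theta theta' z, Theta theta -> Theta theta' -> Z z ->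
     `|f theta z - f theta' z| <= LTheta * norm2 (theta - theta')) ->
  (exists center : 'rV[R]_k,
     forall theta, Theta theta -> norm2 (theta - center) <= RTheta) ->
  exists (I : finType) (net : I -> 'rV[R]_k),
    [/\ #|I|%:R <= (Num.max (LTheta * RTheta / eps) 2 ^+ k) ^+ 7,
        forall i, Theta (net i)
      & forall theta, Theta theta -> exists i, forall z, Z z ->
          `|f theta z - f (net i) z| <= eps / 4].
Proof.
move=> Theta0 eps0 lipf [center ball]; set M := Num.max _ _.
have M2 : 2 <= M by rewrite le_max lexx orbT.
have M1 : 1 <= M by apply: le_trans M2; rewrite ler1n.
(* If [LTheta <= 0], all the functions [f theta] agree on [Z] and one point is a net. *)
have [LTheta0|LTheta0] := leP LTheta 0.
  have [theta0 Ttheta0] := Theta0.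
  exists unit, (fun=> theta0); split=> [|//|theta Ttheta].
    by rewrite card_unit !exprn_ege1.
  exists tt => z Zz; apply: le_trans (lipf _ _ _ Ttheta Ttheta0 Zz) _.
  apply: (@le_trans _ _ 0); last by rewrite divr_ge0 ?ltW.
  by rewrite mulr_le0_ge0 ?norm2_ge0.
have [//||theta Ttheta|I [net [cardI netT net_dist]]] :=
  @euclidean_net R k Theta center (eps / (4 * LTheta)) (4 * M) Theta0.
- by rewrite divr_gt0 ?mulr_gt0.
- by rewrite mulr_gt0// (lt_le_trans _ M2).
- apply: le_trans (ball _ Ttheta) _.
  have -> : 4 * M * (eps / (4 * LTheta)) = M * (eps / LTheta).
    by field; rewrite gt_eqF.
  rewrite mulrA ler_pdivlMr// [_ * LTheta]mulrC -ler_pdivrMr//.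
  by rewrite le_max lexx.
exists I, net; split=> // [|theta Ttheta].
  apply: (le_trans cardI); rewrite -!exprM mulnC exprM.
  have M0 : 0 <= M by lra.
  rewrite lerXn2r ?nnegrE ?exprn_ge0//; first by rewrite !mulr_ge0 ?expR_ge0//; lra.
  (* Origin of the exponent 7: 2e(1+4M) is at most 64M, and 64 = 2^6 is at most M^6. *)
  have M6 : 64 <= M ^+ 6.
    have -> : 64 = 2 ^+ 6 :> R by ring.
    by rewrite lerXn2r ?nnegrE.
  apply: (@le_trans _ _ (64 * M)); last by rewrite exprSr ler_wpM2r.
  have := expR1_le4 R; have := expR_ge0 (1 : R); nra.
have [i close] := net_dist _ Ttheta; exists i => z Zz.
apply: le_trans (lipf _ _ _ Ttheta (netT i) Zz) _.
apply: le_trans (ler_wpM2l (ltW LTheta0) close) _.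
rewrite le_eqVlt; apply/orP; left; apply/eqP; field.
by rewrite gt_eqF.
Qed.

(** Replacing theta by a net point costs eps/4 under each kernel, and the net point itself deviates
    by eps/2; infima inherit the uniform bound. *)
Lemma risk_dist (R : realType) (T : nat) (S A : nat -> finType)
    (c : costs R T S A) (pol : policy R T S A) (K K' : trans_kernel R T S A)
    (k : nat) (Theta : set 'rV[R]_k) (f : 'rV[R]_k -> R -> R) (eps : R)
    (I : finType) (net : I -> 'rV[R]_k) (s : S 0%N) :
  is_cost c -> is_policy pol -> is_trans_kernel K -> is_trans_kernel K' ->
  Theta !=set0 ->
  (forall theta, Theta theta -> exists i, forall z, 0 <= z <= T.+1%:R ->
     `|f theta z - f (net i) z| <= eps / 4) ->
  (forall i, `|expected c K' pol (f (net i)) s - expected c K pol (f (net i)) s|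
     <= eps / 2) ->
  `|risk c Theta f K' pol s - risk c Theta f K pol s| <= eps.
Proof.
move=> cost_c policy_pol kernelK kernelK' Theta0 net_close net_dev.
have close theta : Theta theta -> exists i,
    forall Q : trans_kernel R T S A, is_trans_kernel Q ->
    `|expected c Q pol (f theta) s - expected c Q pol (f (net i)) s| <= eps / 4.
  move=> /net_close[i fi]; exists i => Q kernelQ.
  by rewrite -expectedB norm_expected_le.
(* The infima are genuine only for images bounded below; finiteness of the net provides the
   bound. *)
have lbound (Q : trans_kernel R T S A) : is_trans_kernel Q ->
    has_lbound [set expected c Q pol (f theta) s | theta in Theta].
  move=> kernelQ.
  exists (- (\sum_i `|expected c Q pol (f (net i)) s| + eps / 4)).
  move=> _ [theta Ttheta <-].
  have [i /(_ Q kernelQ)] := close theta Ttheta.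
  have : `|expected c Q pol (f (net i)) s| <=
      \sum_i `|expected c Q pol (f (net i)) s|.
    by rewrite (bigD1 i)//= lerDl sumr_ge0.
  by rewrite !ler_norml => /andP[? _] /andP[? _]; lra.
apply: inf_image_dist => //; [exact: lbound|exact: lbound|].
move=> theta Ttheta; have [i close_i] := close theta Ttheta.
have := close_i _ kernelK; have := close_i _ kernelK'; have := net_dev i.
by rewrite !ler_norml => /andP[? ?] /andP[? ?] /andP[? ?]; apply/andP; split; lra.
Qed.

(** The exponential is at most L^-8. One factor [L] absorbs the number of states over delta, the
    other seven absorb [Mk ^+ 7]. *)
Lemma failure_le (R : realType) (s Mk L delta x : R) :
  1 <= s -> 1 <= Mk -> 0 < delta < 1 -> 8 * s * Mk / delta <= L ->
  8 * ln L <= x -> 2 * s * Mk ^+ 7 * expR (- x) <= delta.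
Proof.
move=> s1 Mk1 /andP[delta0 delta1] L_ge x_ge.
have L_ge_s : 8 * s / delta <= L.
  apply: le_trans L_ge; rewrite ler_wpM2r ?invr_ge0 ?(ltW delta0)//.
  by rewrite ler_peMr//; lra.
have L_ge_Mk : Mk <= L.
  apply: le_trans L_ge; rewrite ler_pdivlMr//.
  by nra.
have L0 : 0 < L by lra.
have expx : expR (- x) <= (L ^+ 8)^-1.
  by rewrite -[in leRHS](lnK L0) -expRM_natl -expRN ler_expR lerN2.
apply: le_trans (ler_wpM2l _ expx) _.
  by rewrite !mulr_ge0 ?exprn_ge0//; lra.
rewrite ler_pdivrMr ?exprn_gt0// exprS.
have Mk7 : Mk ^+ 7 <= L ^+ 7 by rewrite lerXn2r ?nnegrE//; lra.
have s_le : 8 * s <= delta * L by rewrite [leRHS]mulrC -ler_pdivrMr.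
have Mk7_ge0 : 0 <= Mk ^+ 7 by rewrite exprn_ge0//; lra.
by rewrite [leRHS]mulrA ler_pM//; lra.
Qed.

Theorem theorem2p3 (R : realType) :
  exists2 C : R, 0 < C &
  forall (T : nat) (S A : nat -> finType)
    (c : costs R T S A) (K : trans_kernel R T S A)
    (k : nat) (Theta : set 'rV[R]_k) (f : 'rV[R]_k -> R -> R)
    (LC LTheta RTheta : R) (pol : policy R T S A) (Lpi : R),
  (0 < T)%N ->
  is_cost c ->
  is_trans_kernel K ->
  Theta !=set0 ->
  0 < LC ->
  (forall (theta : 'rV[R]_k) (z z' : R), Theta theta ->
     0 <= z <= T.+1%:R -> 0 <= z' <= T.+1%:R ->
     `|f theta z - f theta z'| <= LC * `|z - z'|) ->
  (forall (theta theta' : 'rV[R]_k) (z : R), Theta theta -> Theta theta' ->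
     0 <= z <= T.+1%:R ->
     `|f theta z - f theta' z| <= LTheta * norm2 (theta - theta')) ->
  (exists center : 'rV[R]_k,
     forall theta, Theta theta -> norm2 (theta - center) <= RTheta) ->
  is_policy pol ->
  0 < Lpi ->
  lipschitz_policy pol Lpi ->
  forall (eps delta : R), 0 < eps -> 0 < delta < 1 ->
  forall n : nat,
  n%:Z = Num.ceil (C * (T%:R ^+ 2 * LC ^+ 2 / eps ^+ 2) *
    ln (log_argument T (max_state_card T S) k LC Lpi LTheta RTheta eps delta)) ->
  forall (d : measure_display) (Omega : measurableType d)
    (P : probability Omega R) (X : sample_family T S A n Omega),
  is_sampling K P X ->
  ((1 - delta)%:E <=
   P [set w | (forall s : S 0%N,
        `|risk c Theta f (empirical R X w) pol s - risk c Theta f K pol s|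
          <= eps)%R])%E.
Proof.
(* The tail exponent below is n eps^2 / (8^3 T^2 LC^2), and [failure_le] asks that it be at least 8
   ln L. *)
exists (8 ^+ 4); first by rewrite exprn_gt0.
move=> T S A c K k Theta f LC LTheta RTheta pol Lpi T0 cost_c kernelK Theta0.
move=> LC0 lip_z lip_theta ball policy_pol _ _ eps delta eps0 delta01 n nE.
move=> d Omega P X sampling.
have /andP[delta0 delta1] := delta01.
have [s0 _|S0] := pickP [pred s : S 0%N | true]; last first.
  rewrite (_ : [set w | _] = setT) ?probability_setT ?lee_fin; first by lra.
  by apply/seteqP; split=> // w _ s; have := S0 s.
set M := Num.max (LTheta * RTheta / eps) 2.
have M1 : 1 <= M ^+ k.
  by rewrite exprn_ege1// (@le_trans _ _ 2) ?ler1n// le_max lexx orbT.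
set cardS := max_state_card T S in nE.
have card_S0 : (#|{: S 0%N}| <= cardS)%N.
  exact: (leq_bigmax (ord0 : 'I_T.+1)).
have cardS1 : 1 <= cardS%:R :> R.
  by rewrite ler1n (leq_trans _ card_S0)//; apply/card_gt0P; exists s0.
set L := log_argument _ _ _ _ _ _ _ _ _ in nE.
have L_ge : 8 * cardS%:R * M ^+ k / delta <= L by exact: log_argument_ge.
(* Makes [ln L] positive, which rules out n = 0 and allows writing n as [m.+1]. *)
have L_gt1 : 1 < L.
  apply: lt_le_trans L_ge; rewrite ltr_pdivlMr// mul1r.
  by apply: lt_le_trans delta1 _; nra.
have TR0 : 0 < T%:R :> R by rewrite ltr0n.
have n_ge : 8 ^+ 4 * (T%:R ^+ 2 * LC ^+ 2 / eps ^+ 2) * ln L <= n%:R.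
  by have := ceil_ge (8 ^+ 4 * (T%:R ^+ 2 * LC ^+ 2 / eps ^+ 2) * ln L); rewrite -nE.
case: n nE n_ge X sampling => [|m] nE n_ge X sampling.
  move: n_ge; rewrite leNgt mulr_gt0 ?ln_gt0// mulr_gt0// divr_gt0 ?exprn_gt0//.
  by rewrite mulr_gt0 ?exprn_gt0.
have [I [net [cardI netT net_close]]] := parameter_net Theta0 eps0 lip_theta ball.
pose dev (s : S 0%N) (i : I) (D : {ffun 'I_m.+1 -> dynamics T S A}) : R :=
  `|expected c (average_kernel R D) pol (f (net i)) s -
  expected c K pol (f (net i)) s|.
pose good (D : {ffun 'I_m.+1 -> dynamics T S A}) : bool :=
  [forall s : S 0%N, [forall i : I, dev s i D <= eps / 2]].
(* Bounds LC (T + 1), the oscillation of [f theta] on the range of total costs, using that T is at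
   least 1. *)
pose B : R := 2 * LC * T%:R.
have tail s i : \sum_(D | eps / 2 < dev s i D) samples_prob K D <=
    2 * expR (- ((eps / 2) ^+ 2 * m.+1%:R / (32 * B ^+ 2))).
  (* Subtracting the value at 0 makes the cost bounded; constants have the same expectation under
     both kernels, so the deviation is unchanged. *)
  pose g z := f (net i) z - f (net i) 0.
  have gB z : 0 <= z <= T.+1%:R -> `|g z| <= B.
    move=> /andP[z0 zT]; have zT' : 0 <= z <= T.+1%:R by rewrite z0.
    apply: le_trans (lip_z _ _ _ (netT i) zT' _) _; first by rewrite lexx ler0n.
    rewrite subr0 ger0_norm// /B -mulrA mulrCA ler_wpM2l ?(ltW LC0)//.
    apply: le_trans zT _; rewrite -natrM ler_nat mul2n -addnn -addn1 leq_add2l.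
    exact: T0.
  have B0 : 0 < B by rewrite !mulr_gt0.
  have eps2 : 0 < eps / 2 by rewrite divr_gt0.
  have := expected_tail m kernelK cost_c policy_pol s B0 eps2 gB.
  rewrite (eq_bigl (fun D => eps / 2 < dev s i D))// => D.
  rewrite /dev /g !(expectedB _ _ _ (f (net i)) (fun=> f (net i) 0)).
  rewrite !expected_cst//; last exact: average_kernelP.
  by rewrite opprB addrA subrK.
have bad_le : \sum_(D | ~~ good D) samples_prob K D <= delta.
  (* Union bound over initial states and net points: a bad [D] is counted by at least one pair. *)
  apply: (@le_trans _ _ (\sum_(s : S 0%N) \sum_(i : I)
      \sum_(D | eps / 2 < dev s i D) samples_prob K D)).
    under [leRHS]eq_bigr => s _ do
      under eq_bigr => i _ do rewrite big_mkcond.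
    under [leRHS]eq_bigr => s _ do rewrite exchange_big.
    rewrite exchange_big/= big_mkcond/=; apply: ler_sum => D _.
    have term_ge0 s i : 0 <= if eps / 2 < dev s i D then samples_prob K D else 0.
      by case: ifP => // _; exact: samples_prob_ge0.
    case: ifP => [|_]; last by apply: sumr_ge0 => s _; apply: sumr_ge0.
    rewrite negb_forall => /existsP[s]; rewrite negb_forall => /existsP[i].
    rewrite -ltNge => bad; rewrite (bigD1 s)//= (bigD1 i)//= bad -addrA lerDl.
    by rewrite addr_ge0// sumr_ge0// => *; rewrite ?sumr_ge0.
  apply: le_trans (ler_sum _ (fun s _ => ler_sum _ (fun i _ => tail s i))) _.
  set x := (eps / 2) ^+ 2 * _ / _.
  rewrite !sumr_const -mulrnA -[leLHS]mulr_natl natrM.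
  apply: le_trans (failure_le cardS1 M1 delta01 L_ge (x := x) _).
    rewrite mulrA [2 * _]mulrC ler_wpM2r ?expR_ge0//.
    by rewrite [leRHS]mulrAC ler_wpM2r// [leLHS]mulrC ler_pM// ler_nat.
  have -> : x = m.+1%:R / (8 ^+ 3 * (T%:R ^+ 2 * LC ^+ 2 / eps ^+ 2)).
    by rewrite /x /B; field; rewrite !gt_eqF.
  rewrite ler_pdivlMr; first by apply: le_trans n_ge; lra.
  by rewrite mulr_gt0// divr_gt0 ?exprn_gt0// mulr_gt0 ?exprn_gt0.
pose accurate (D : {ffun 'I_m.+1 -> dynamics T S A}) : bool := [forall s : S 0%N,
  `|risk c Theta f (average_kernel R D) pol s - risk c Theta f K pol s| <= eps].
have good_accurate D : good D -> accurate D.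
  move=> /forallP good_D; apply/forallP => s.
  apply: (risk_dist cost_c policy_pol kernelK _ Theta0 net_close).
    exact: average_kernelP.
  by move=> i; have /forallP := good_D s; apply.
have sampledE w : empirical R X w = average_kernel R (sampled_dynamics X w).
  apply: functional_extensionality_dep => t.
  by apply/funext => s; apply/funext => a; apply/funext => s'; exact: empiricalE.
(* The event depends on the samples only through [sampled_dynamics], which has finitely many values,
   so its probability is a finite sum of [samples_prob]. *)
have -> : [set w | forall s : S 0%N,
      `|risk c Theta f (empirical R X w) pol s - risk c Theta f K pol s| <= eps] =
    [set w | accurate (sampled_dynamics X w)].
  apply/seteqP; split=> w /=.
    by move=> acc; apply/forallP => s; rewrite -sampledE.
  by move=> /forallP acc s; rewrite sampledE.
have law := sampled_dynamics_law sampling.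
rewrite (probability_finite_event accurate (fun D => (law D).1)
  (fun D => (law D).2)) lee_fin.
have := sum_samples_prob m kernelK; rewrite (bigID good)/=.
have : \sum_(D | good D) samples_prob K D <= \sum_(D | accurate D) samples_prob K D.
  rewrite big_mkcond [leRHS]big_mkcond; apply: ler_sum => D _.
  by case: ifP => [/good_accurate ->|_]//; case: ifP => // _; exact: samples_prob_ge0.
by lra.
Qed.
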